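(* Let $\mathcal{A}$ be a finite structure with domain $A$ and let $U,X\subseteq A$. The following are equivalent: (i) $\mathcal{A}$ has $\forall U$-$\exists X$-relativisation; (ii) $\mathcal{A}$ has a surjective hyper-endomorphism that is $X$-total and $U$-surjective.
   Context: Structures are finite relational structures with nonempty domain. $\{\exists,\forall,\wedge,\vee\}\text{-FO}$ is the set of first-order sentences built from relational atoms (no equality, no negation) using $\wedge,\vee,\exists,\forall$. A shop of $A$ is a map $f$ from $A$ to the power set of $A$ with $f(a)\ne\emptyset$ for all $a$ and $\bigcup_{a\in A}f(a)=A$; it is a surjective hyper-endomorphism of $\mathcal{A}$ if for every relation $R$ of arity $i$, $R(a_1,\dots,a_i)$ in $\mathcal{A}$ implies $R(b_1,\dots,b_i)$ in $\mathcal{A}$ for all $b_j\in f(a_j)$. For $S\subseteq A$ write $f(S)=\bigcup_{s\in S}f(s)$. $f$ is $U$-surjective if $f(U)=A$, and $X$-total if every $a\in A$ has $f(a)\cap X\neq\emptyset$. For a sentence $\varphi$, $\varphi_{[\forall u/\forall u\in U]}$ denotes $\varphi$ with every universal quantifier relativised to $U$, $\varphi_{[\exists x/\exists x\in X]}$ denotes $\varphi$ with every existential quantifier relativised to $X$, and $\varphi_{[\forall u/\forall u\in U,\exists x/\exists x\in X]}$ does both. $\mathcal{A}$ has $\forall U$-$\exists X$-relativisation if for every sentence $\varphi$ of $\{\exists,\forall,\wedge,\vee\}\text{-FO}$ the four statements $\mathcal{A}\models\varphi$, $\mathcal{A}\models\varphi_{[\forall u/\forall u\in U]}$, $\mathcal{A}\models\varphi_{[\exists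 x/\exists x\in X]}$, $\mathcal{A}\models\varphi_{[\forall u/\forall u\in U,\exists x/\exists x\in X]}$ are equivalent.
   Formalization: U and X are assumed nonempty; for empty U (one-element structure with X = A and a full unary relation) or empty X (one-element structure with U = A and an empty unary relation), (i) holds while (ii) fails. *)

(* Defs.v *)
From mathcomp Require Import all_boot.

Set Implicit Arguments.
Unset Strict Implicit.
Unset Printing Implicit Defensive.

Record signature : Type := Signature {
  symbol :> Type;
  arity : symbol -> nat
}.

Record structure (sg : signature) : Type := Structure {
  domain :> finType;
  domain_nonempty : 0 < #|domain|;
  interp : forall R : sg, {set (arity R).-tuple domain}
}.

(* Formulas of {exists, forall, /\, \/}-FO; variables are natural numbers. *)
Inductive formula (sg : signature) : Type :=
| Atom (R : sg) (v : (arity R).-tuple nat)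
| And (p q : formula sg)
| Or (p q : formula sg)
| Exists (x : nat) (p : formula sg)
| Forall (x : nat) (p : formula sg).

Fixpoint free_vars (sg : signature) (p : formula sg) : seq nat :=
  match p with
  | Atom _ v => v
  | And p q | Or p q => free_vars p ++ free_vars q
  | Exists x p | Forall x p => [seq y <- free_vars p | y != x]
  end.

Definition sentence (sg : signature) (p : formula sg) : bool :=
  nilp (free_vars p).

Fixpoint sat (sg : signature) (A : structure sg) (e : nat -> A)
    (p : formula sg) : Prop :=
  match p with
  | Atom _ v => map_tuple e v \in interp A _
  | And p q => sat e p /\ sat e q
  | Or p q => sat e p \/ sat e q
  | Exists x p => exists a : A, sat [eta e with x |-> a] p
  | Forall x p => forall a : A, sat [eta e with x |-> a] p
  end.

(* Only used for sentences, whose truth value does not depend on [e]; the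
   domain being nonempty, the quantification over [e] is not vacuous. *)
Definition models (sg : signature) (A : structure sg) (p : formula sg) : Prop :=
  forall e : nat -> A, sat e p.

(* The same formulas, where in addition a quantifier may be relativised to a
   subset of [D]: [RExists x (Some B) p] is "exists x in B, p", and
   [RExists x None p] is the plain "exists x, p". *)
Inductive rformula (sg : signature) (D : finType) : Type :=
| RAtom (R : sg) (v : (arity R).-tuple nat)
| RAnd (p q : rformula sg D)
| ROr (p q : rformula sg D)
| RExists (x : nat) (B : option {set D}) (p : rformula sg D)
| RForall (x : nat) (B : option {set D}) (p : rformula sg D).

Arguments RAtom {sg} D R v.

Fixpoint rsat (sg : signature) (A : structure sg) (e : nat -> A)
    (p : rformula sg A) : Prop :=
  match p with
  | RAtom _ v => map_tuple e v \in interp A _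
  | RAnd p q => rsat e p /\ rsat e q
  | ROr p q => rsat e p \/ rsat e q
  | RExists x None p => exists a : A, rsat [eta e with x |-> a] p
  | RExists x (Some B) p =>
      exists a : A, a \in B /\ rsat [eta e with x |-> a] p
  | RForall x None p => forall a : A, rsat [eta e with x |-> a] p
  | RForall x (Some B) p =>
      forall a : A, a \in B -> rsat [eta e with x |-> a] p
  end.

Definition rmodels (sg : signature) (A : structure sg)
    (p : rformula sg A) : Prop :=
  forall e : nat -> A, rsat e p.

(* [oU] bounds every universal quantifier, [oX] every existential one. *)
Fixpoint relativise (sg : signature) (D : finType) (oU oX : option {set D})
    (p : formula sg) : rformula sg D :=
  match p with
  | Atom _ v => RAtom D _ v
  | And p q => RAnd (relativise oU oX p) (relativise oU oX q)
  | Or p q => ROr (relativise oU oX p) (relativise oU oX q)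
  | Exists x p => RExists x oX (relativise oU oX p)
  | Forall x p => RForall x oU (relativise oU oX p)
  end.

Definition has_relativisation (sg : signature) (A : structure sg)
    (U X : {set A}) : Prop :=
  forall p : formula sg, sentence p ->
    [/\ models A p <-> rmodels (relativise (Some U) None p),
        models A p <-> rmodels (relativise None (Some X) p)
      & models A p <-> rmodels (relativise (Some U) (Some X) p)].

Definition image_of (D : finType) (f : D -> {set D}) (S : {set D}) : {set D} :=
  \bigcup_(s in S) f s.

Definition shop (D : finType) (f : D -> {set D}) : Prop :=
  (forall a, f a != set0) /\ \bigcup_a f a = [set: D].

Definition surjective_hyper_endomorphism (sg : signature) (A : structure sg)
    (f : A -> {set A}) : Prop :=
  shop f /\
  forall (R : sg) (a b : (arity R).-tuple A),
    a \in interp A R -> (forall j, tnth b j \in f (tnth a j)) ->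
    b \in interp A R.

Definition surjective_from (D : finType) (U : {set D}) (f : D -> {set D}) :
    Prop :=
  image_of f U = [set: D].

Definition total_into (D : finType) (X : {set D}) (f : D -> {set D}) : Prop :=
  forall a, f a :&: X != set0.

(* Main.v *)
(** For (ii) => (i), a hyper-endomorphism [f] transports satisfaction from an
    assignment [e] to any assignment [e'] with [e' x \in f (e x)]:
    [U]-surjectivity answers a universal challenge by an element of [U], and
    [X]-totality moves an existential witness into [X].

    For (i) => (ii), consider a sentence
    [exists (v_a)_(a in A), forall (w_i)_(i in A), \/_(t : A -> U) D_t(v, w)]
    where [D_t] is the positive diagram of [A] with [v_a] labelled [a] and
    [w_i] labelled [t i]. It holds when the universal quantifiers are
    relativised to [U] (take [v_a = a] and [t = w]), hence also when the
    existential ones are relativised to [X]. Playing [w_i = i] then yields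
    [v] and [t], and sending [a] to the values of all variables labelled [a]
    is the desired map. As the signature may be infinite, [D_t] only
    mentions one fact for each of the finitely many candidate maps, chosen so
    that a candidate preserving that fact preserves all of them. *)

Require Import Defs.
From mathcomp Require Import all_boot.
From Stdlib Require Import Classical.

Set Implicit Arguments.
Unset Strict Implicit.
Unset Printing Implicit Defensive.

(** * Relativised satisfaction and its transport along a map *)

Definition bounded (D : finType) (oB : option {set D}) (a : D) : bool :=
  if oB is Some B then a \in B else true.

Section Relativised.

Variables (sg : signature) (A : structure sg).
Implicit Types (e : nat -> A) (p q : formula sg) (oU oX : option {set A}).

Lemma rsat_exists e x oX (p : rformula sg A) :
  rsat e (RExists x oX p) <->
  exists a, bounded oX a /\ rsat [eta e with x |-> a] p.
Proof.
by case: oX => [X|] //=; split=> [[a]|[a []]]; exists a.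
Qed.

Lemma rsat_forall e x oU (p : rformula sg A) :
  rsat e (RForall x oU p) <->
  forall a, bounded oU a -> rsat [eta e with x |-> a] p.
Proof. by case: oU => [U|] //=; split=> h a => [|] *; apply: h. Qed.

Lemma sat_relativise_none e p : sat e p <-> rsat e (relativise None None p).
Proof.
elim: p e => //= [p IHp q IHq|p IHp q IHq|x p IHp|x p IHp] e.
- by rewrite IHp IHq.
- by rewrite IHp IHq.
- by split=> -[a /IHp]; exists a.
- by split=> h a; apply/IHp.
Qed.

Lemma models_relativise_none p :
  models A p <-> rmodels (A := A) (relativise None None p).
Proof. by split=> h e; apply/sat_relativise_none. Qed.

(** Stated for one tuple, because the canonical sentence controls only finitely many facts. *)
Definition preserves (f : A -> {set A}) (R : sg) (a : (arity R).-tuple A) :=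
  forall b : (arity R).-tuple A,
    (forall j, tnth b j \in f (tnth a j)) -> b \in interp A R.

(** Induction on [p]: witnesses are pushed forward along [f], universal challenges pulled back.
    Independent bounds on the two sides cover all passages between relativisations. *)
Lemma rsat_transport (f : A -> {set A}) oU oX oU' oX' p e e' :
  (forall (R : sg) (a : (arity R).-tuple A),
     a \in interp A R -> preserves f a) ->
  (forall b, bounded oU' b -> exists2 a, bounded oU a & b \in f a) ->
  (forall a, bounded oX a -> exists2 b, bounded oX' b & b \in f a) ->
  (forall x, e' x \in f (e x)) ->
  rsat e (relativise oU oX p) -> rsat e' (relativise oU' oX' p).
Proof.
move=> fP fU fX.
have upd e1 e2 x a b : (forall y, e2 y \in f (e1 y)) -> b \in f a ->
    forall y, [eta e2 with x |-> b] y \in f ([eta e1 with x |-> a] y).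
  by move=> h ab y /=; case: ifP.
elim: p e e' => [R v|p IHp q IHq|p IHp q IHq|x p IHp|x p IHp] e e' ee'.
- by move=> /= ev; apply: (fP _ _ ev) => j; rewrite !tnth_map.
- by case=> /(IHp _ _ ee') ? /(IHq _ _ ee') ?; split.
- by case=> [/(IHp _ _ ee')|/(IHq _ _ ee')]; [left|right].
- case/rsat_exists=> a [/fX[b bX ab]] pa; apply/rsat_exists; exists b.
  by split=> //; apply: IHp pa; apply: upd.
- move/rsat_forall=> pU; apply/rsat_forall => b /fU[a aU ab].
  by apply: IHp (pU a aU); apply: upd.
Qed.

Lemma eq_interp (R : sg) (a b : (arity R).-tuple A) :
  tnth a =1 tnth b -> a \in interp A R -> b \in interp A R.
Proof. by move=> /eq_from_tnth->. Qed.

Lemma eq_rsat oU oX p e e' :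
  e =1 e' -> rsat e (relativise oU oX p) -> rsat e' (relativise oU oX p).
Proof.
(* Transport along the singleton map avoids functional extensionality. *)
move=> ee'; apply: (@rsat_transport (fun a => [set a])).
- move=> R a aR b ab; apply: eq_interp aR => j.
  by apply/esym/set1P.
- by move=> b bU; exists b => //; apply: set11.
- by move=> a aX; exists a => //; apply: set11.
- by move=> x; rewrite ee' set11.
Qed.

Lemma rmodels_transport (f : A -> {set A}) oU oX oU' oX' p :
  (forall (R : sg) (a : (arity R).-tuple A),
     a \in interp A R -> preserves f a) ->
  (forall b, exists2 a, bounded oU a & b \in f a) ->
  (forall a, exists2 b, bounded oX' b & b \in f a) ->
  rmodels (A := A) (relativise oU oX p) ->
  rmodels (A := A) (relativise oU' oX' p).
Proof.
move=> fP fU fX pA e'.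
(* Truth concerns every assignment, so each [e'] is pulled back to [g \o e'] by choosing preimages
   under [f]. *)
have /fin_all_exists[g gP] : forall b, exists a, b \in f a.
  by move=> b; have [a _ ?] := fU b; exists a.
by apply: (rsat_transport fP _ _ _ (pA (g \o e'))) => // x; apply: gP.
Qed.

(** * Blocks of quantifiers *)

Definition override (xs : seq nat) e' e x := if x \in xs then e' x else e x.

Lemma rsat_foldr_exists oU oX xs p e :
  rsat e (relativise oU oX (foldr (@Exists sg) p xs)) <->
  exists2 e', {in xs, forall x, bounded oX (e' x)} &
    rsat (override xs e' e) (relativise oU oX p).
Proof.
elim: xs e => [|x xs IHxs] e; first by split=> [|[e' _]] pe; [exists e|].
split.
- case/rsat_exists=> a [aX] /IHxs[e' e'X pe'].
  (* [x] may recur in [xs]; the inner quantifier then wins, so [a] serves only outside [xs]. *)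
  exists (override xs e' [eta e with x |-> a]).
    move=> y; rewrite inE /override /=.
    by case: ifP => [/e'X //|_]; rewrite orbF => ->.
  apply: eq_rsat pe' => y; rewrite /override /= inE.
  by case: (y \in xs); rewrite ?orbT ?orbF //; case: ifP.
- case=> e' e'X pe'; apply/rsat_exists; exists (e' x).
  split; first by apply: e'X; rewrite mem_head.
  apply/IHxs; exists e' => [y yxs|]; first by apply: e'X; rewrite inE yxs orbT.
  apply: eq_rsat pe' => y; rewrite /override /= inE.
  by case: eqP => [->|] //=; case: ifP.
Qed.

Lemma rsat_foldr_forall oU oX xs p e :
  rsat e (relativise oU oX (foldr (@Forall sg) p xs)) <->
  forall e', {in xs, forall x, bounded oU (e' x)} ->
    rsat (override xs e' e) (relativise oU oX p).
Proof.
elim: xs e => [|x xs IHxs] e.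
  by split=> [pe e' _|h]; [apply: eq_rsat pe|apply: (h e)].
split.
- move/rsat_forall=> h e' e'U.
  have /h/IHxs/(_ e') := e'U x (mem_head _ _).
  have e'U' : {in xs, forall y, bounded oU (e' y)}.
    by move=> y yxs; apply: e'U; rewrite inE yxs orbT.
  move=> /(_ e'U'); apply: eq_rsat => y; rewrite /override /= inE.
  by case: eqP => [->|] //=; case: ifP.
- move=> h; apply/rsat_forall => a aU; apply/IHxs => e' e'U.
  have e''U : {in x :: xs, forall y,
      bounded oU (override xs e' [eta e with x |-> a] y)}.
    move=> y; rewrite inE /override /=.
    by case: ifP => [/e'U //|_]; rewrite orbF => ->.
  apply: eq_rsat (h _ e''U) => y; rewrite /override /= inE.
  by case: (y \in xs); rewrite ?orbT ?orbF //; case: (y == x).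
Qed.

End Relativised.

(* The language has neither truth nor falsity, hence the extra formula [p]
   standing for the empty conjunction or disjunction. *)
Definition conj (sg : signature) (I : Type) (p : formula sg) (r : seq I)
    (F : I -> formula sg) : formula sg := foldr (fun i => And (F i)) p r.

Definition disj (sg : signature) (I : Type) (p : formula sg) (r : seq I)
    (F : I -> formula sg) : formula sg := foldr (fun i => Or (F i)) p r.

(** * Finite conjunctions and disjunctions, and free variables *)

Section Formulas.

Variables (sg : signature) (I : eqType).
Implicit Types (p : formula sg) (r : seq I) (F : I -> formula sg).

Lemma rsat_conj (A : structure sg) (e : nat -> A) oU oX p r F :
  rsat e (relativise oU oX (conj p r F)) <->
  rsat e (relativise oU oX p) /\
  {in r, forall i, rsat e (relativise oU oX (F i))}.
Proof.
elim: r => [|i r IHr] /=; first by split=> [|[]].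
rewrite IHr; split=> [[pi [p0 pr]]|[p0 pr]].
  by split=> // j; rewrite inE => /predU1P[->|/pr].
split; first by apply: pr; rewrite mem_head.
by split=> // j jr; apply: pr; rewrite inE jr orbT.
Qed.

Lemma rsat_disj (A : structure sg) (e : nat -> A) oU oX p r F :
  rsat e (relativise oU oX (disj p r F)) <->
  rsat e (relativise oU oX p) \/
  exists2 i, i \in r & rsat e (relativise oU oX (F i)).
Proof.
elim: r => [|i r IHr] /=; first by split=> [|[|[]]] //; left.
rewrite IHr; split=> [[pi|[p0|[j jr pj]]]|[p0|[j]]].
- by right; exists i; rewrite ?mem_head.
- by left.
- by right; exists j; rewrite // inE jr orbT.
- by right; left.
- by rewrite inE => /predU1P[->|jr] pj; [left|right; right; exists j].
Qed.

Lemma free_vars_conj p r F (S : pred nat) :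
  all S (free_vars p) -> {in r, forall i, all S (free_vars (F i))} ->
  all S (free_vars (conj p r F)).
Proof.
move=> Sp; elim: r => [|i r IHr] //= Sr.
rewrite all_cat Sr ?mem_head // IHr // => j jr.
by apply: Sr; rewrite inE jr orbT.
Qed.

Lemma free_vars_disj p r F (S : pred nat) :
  all S (free_vars p) -> {in r, forall i, all S (free_vars (F i))} ->
  all S (free_vars (disj p r F)).
Proof.
move=> Sp; elim: r => [|i r IHr] //= Sr.
rewrite all_cat Sr ?mem_head // IHr // => j jr.
by apply: Sr; rewrite inE jr orbT.
Qed.

Lemma free_vars_foldr_exists p xs :
  free_vars (foldr (@Exists sg) p xs) = [seq y <- free_vars p | y \notin xs].
Proof.
elim: xs => [|x xs /= ->] /=; first by rewrite filter_predT.
by rewrite -filter_predI; apply: eq_filter => y; rewrite inE negb_or.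
Qed.

Lemma free_vars_foldr_forall p xs :
  free_vars (foldr (@Forall sg) p xs) = [seq y <- free_vars p | y \notin xs].
Proof.
elim: xs => [|x xs /= ->] /=; first by rewrite filter_predT.
by rewrite -filter_predI; apply: eq_filter => y; rewrite inE negb_or.
Qed.

End Formulas.

(** * The canonical sentence and the map read off from it *)

Definition fact (sg : signature) (A : structure sg) : Type :=
  {R : sg & {a : (arity R).-tuple A | a \in interp A R}}.

Section CanonicalSentence.

Variables (sg : signature) (A : structure sg) (U X : {set A}) (u0 : A).
Variables (I : finType) (i0 : I) (w : I -> fact A).

(* [inl a] is the existential variable [v_a], and [inr i] the universal
   variable [w_i]; [pickle] turns them into natural numbers. *)
Let V : finType := (A + A)%type.
Let var : V -> nat := pickle.

Definition label (t : A -> A) (v : V) : A :=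
  match v with inl a => a | inr i => t i end.

(** A stand-in for truth: since [inl a] is labelled [a], this atom is already among the conjuncts of
    [diagram t] for every [t]. *)
Definition basic_atom : formula sg :=
  Atom (map_tuple (var \o inl) (sval (tagged (w i0)))).

(** Several variables can share a label, so every tuple of variables spelling a chosen fact
    contributes an atom. *)
Definition diagram (t : A -> A) : formula sg :=
  conj basic_atom (enum I) (fun i =>
    conj basic_atom
      [seq s <- enum {: (arity (tag (w i))).-tuple V}
         | map_tuple (label t) s == sval (tagged (w i))]
      (fun s => Atom (map_tuple var s))).

Definition existential_vars : seq nat := [seq var (inl a) | a <- enum A].
Definition universal_vars : seq nat := [seq var (inr a) | a <- enum A].

(** The default disjunct belongs to a constant map, itself one of the indexed maps once [u0] lies in
    [U]. *)
Definition canonical_sentence : formula sg :=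
  foldr (@Exists sg)
    (foldr (@Forall sg)
      (disj (diagram (fun=> u0))
         (enum [pred t : {ffun A -> A} | t \in ffun_on U]) diagram)
      universal_vars)
    existential_vars.

Lemma var_inj : injective var.
Proof. exact: pcan_inj pickleK. Qed.

Lemma mem_existential_vars v :
  (var v \in existential_vars) = (if v is inl _ then true else false).
Proof.
apply/mapP/idP => [[a _ /var_inj-> //]|]; case: v => // a _.
by exists a; rewrite ?mem_enum.
Qed.

Lemma mem_universal_vars v :
  (var v \in universal_vars) = (if v is inr _ then true else false).
Proof.
apply/mapP/idP => [[a _ /var_inj-> //]|]; case: v => // a _.
by exists a; rewrite ?mem_enum.
Qed.

Lemma free_vars_diagram t : all [in codom var] (free_vars (diagram t)).
Proof.
have allS n (s : n.-tuple V) : all [in codom var] (map var s).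
  by apply/allP => _ /mapP[v _ ->]; apply: codom_f.
have basicS : all [in codom var] (free_vars basic_atom).
  by rewrite /= map_comp; apply: (allS _ (map_tuple inl _)).
apply: free_vars_conj => // i _; apply: free_vars_conj => // s _; exact: allS.
Qed.

Lemma sentence_canonical : sentence canonical_sentence.
Proof.
rewrite /sentence free_vars_foldr_exists free_vars_foldr_forall.
rewrite -filter_predI /nilp size_filter -leqn0 leqNgt -has_count.
apply/hasPn => x xD.
have /codomP[v ->] : x \in codom var.
  apply: (allP _ _ xD); apply: free_vars_disj => [|t _];
  exact: free_vars_diagram.
by rewrite /= mem_existential_vars mem_universal_vars; case: v.
Qed.

Lemma rsat_diagram (e : nat -> A) oU oX t :
  rsat e (relativise oU oX (diagram t)) <->
  forall i (s : (arity (tag (w i))).-tuple V),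
    map_tuple (label t) s = sval (tagged (w i)) ->
    map_tuple (e \o var) s \in interp A (tag (w i)).
Proof.
have mapE n (s : n.-tuple V) :
    map_tuple e (map_tuple var s) = map_tuple (e \o var) s.
  by apply: val_inj; rewrite /= map_comp.
split=> [/rsat_conj[_ De] i s sE|De].
  have /rsat_conj[_ /(_ s)] := De i (mem_enum _ _).
  by rewrite mem_filter sE eqxx mem_enum /= mapE; apply.
have basicS : rsat e (relativise oU oX basic_atom).
  have /De : map_tuple (label t) (map_tuple inl (sval (tagged (w i0))))
      = sval (tagged (w i0)).
    by apply: val_inj; rewrite /= -map_comp map_id.
  by apply: eq_interp => j; rewrite !tnth_map.
apply/rsat_conj; split=> // i _; apply/rsat_conj; split=> // s.
by rewrite mem_filter /= mapE => /andP[/eqP/De].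
Qed.

Lemma rmodels_canonical_forall :
  rmodels (A := A) (relativise (Some U) None canonical_sentence).
Proof.
move=> e; apply/rsat_foldr_exists.
pose e1 x := if (pickle_inv x : option V) is Some (inl a) then a else e x.
exists e1 => //.
apply/rsat_foldr_forall => e' e'U; apply/rsat_disj; right.
(* The values of the universal variables lie in [U] and select the disjunct. *)
exists [ffun i => e' (var (inr i))].
  rewrite mem_enum; apply/ffun_onP => i; rewrite ffunE.
  by apply: e'U; rewrite mem_universal_vars.
apply/rsat_diagram => i s sE.
apply: eq_interp (svalP (tagged (w i))) => j.
(* Each variable takes its label as value, so every atom becomes a chosen fact. *)
rewrite -[in LHS]sE !tnth_map /= /override.
rewrite mem_universal_vars mem_existential_vars.
by case: (tnth s j) => a /=; rewrite /e1 ?pickleK_inv ?ffunE.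
Qed.

Lemma rmodels_canonical_exists :
  u0 \in U ->
  rmodels (A := A) (relativise None (Some X) canonical_sentence) ->
  exists f : A -> {set A},
    [/\ forall i, preserves f (sval (tagged (w i))),
        shop f, total_into X f & surjective_from U f].
Proof.
move=> u0U /(_ (fun=> u0)) /rsat_foldr_exists[e1 e1X] /rsat_foldr_forall.
pose e2 x := if (pickle_inv x : option V) is Some (inr a) then a else u0.
move=> /(_ e2 (fun _ _ => isT)).
set e := override _ _ _ => /rsat_disj De.
have {De} [t tU /rsat_diagram De] : exists2 t : A -> A,
    forall i, t i \in U & rsat e (relativise None (Some X) (diagram t)).
  case: De => [|[t]]; first by exists (fun=> u0).
  by rewrite mem_enum => /ffun_onP tU De; exists t.
have eX a : e (var (inl a)) \in X.
  rewrite /e /override mem_universal_vars mem_existential_vars /=.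
  by apply: e1X; rewrite mem_existential_vars.
have eT a : e (var (inr a)) = a.
  by rewrite /e /override mem_universal_vars /= /e2 pickleK_inv.
(* The value of [v_a] gives [X]-totality; [w_b] puts [b] in [f (t b)] with [t b] in [U], which gives
   [U]-surjectivity. *)
pose f a := [set e (var v) | v : V & label t v == a].
have fX a : e (var (inl a)) \in f a :&: X.
  by rewrite inE eX andbT; apply/imsetP; exists (inl a); rewrite ?inE.
have fU b : b \in f (t b).
  by apply/imsetP; exists (inr b); rewrite ?inE ?eT.
exists f; split; last 1 first.
- by apply/setP => b; rewrite inE; apply/bigcupP; exists (t b).
- move=> i b bf.
  (* Each coordinate of [b] is the value of a variable with the right label; these variables form a
     tuple treated by the diagram. *)
  have /fin_all_exists[s sP] : forall j, exists v : V,
      label t v = tnth (sval (tagged (w i))) j /\ e (var v) = tnth b j.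
    move=> j; by have /imsetP[v /[!inE]/eqP vE bE] := bf j; exists v.
  have /De : map_tuple (label t) (mktuple s) = sval (tagged (w i)).
    by apply: eq_from_tnth => j; rewrite tnth_map tnth_mktuple (sP j).1.
  apply: eq_interp => j.
  by rewrite tnth_map tnth_mktuple /= (sP j).2.
- split=> [a|].
    by apply/set0Pn; exists (e (var (inl a))); case/setIP: (fX a).
  by apply/setP => b; rewrite inE; apply/bigcupP; exists (t b).
- by move=> a; apply/set0Pn; exists (e (var (inl a))).
Qed.

End CanonicalSentence.

Theorem theorem3 (sg : signature) (A : structure sg) (U X : {set A})
    (U_nonempty : U != set0) (X_nonempty : X != set0) :
  has_relativisation U X <->
  exists f : A -> {set A},
    [/\ surjective_hyper_endomorphism f, total_into X f & surjective_from U f].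
Proof.
split=> [relA|[f [[_ fhom] fX fU]] p _]; last first.
  have fP (R : sg) (a : (arity R).-tuple A) :
      a \in interp A R -> preserves f a.
    by move=> aR b; apply: fhom.
  have fU' b : exists2 a, a \in U & b \in f a.
    by apply/bigcupP; move/setP/(_ b): fU; rewrite /image_of inE.
  have fX' a : exists2 b, b \in X & b \in f a.
    by have /set0Pn[b /setIP[]] := fX a; exists b.
  have fU0 b : exists2 a, true & b \in f a by case: (fU' b) => a; exists a.
  have fX0 a : exists2 b, true & b \in f a by case: (fX' a) => b; exists b.
  have trans oU oX oU' oX' := @rmodels_transport _ A f oU oX oU' oX' p fP.
  by split; rewrite models_relativise_none; split; apply: trans.
have [u0 u0U] := set0Pn _ U_nonempty.
(* Without any fact, preservation is vacuous and the constant full map works. *)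
have [[w0]|noW] := classic (inhabited (fact A)); last first.
  exists (fun=> [set: A]); split.
  - split; last by move=> R a b aR; case: noW; split; exists R; exists a.
    split; first by move=> _; apply/set0Pn; exists u0; rewrite inE.
    by apply/setP => b; rewrite inE; apply/bigcupP; exists u0; rewrite ?inE.
  - by move=> a; rewrite setTI.
  - by apply/setP => b; rewrite inE; apply/bigcupP; exists u0; rewrite ?inE.
(* Each of the finitely many candidates gets a fact it violates, or [w0] if it preserves all. *)
have /fin_all_exists[w wP] : forall f : {ffun A -> {set A}}, exists y : fact A,
    preserves f (sval (tagged y)) ->
    forall x : fact A, preserves f (sval (tagged x)).
  move=> f; have [h|/not_all_ex_not[x hx]] :=
    classic (forall x : fact A, preserves f (sval (tagged x))).
  - by exists w0.
  - by exists x => /hx.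
(* [[ffun=> set0]] is an arbitrary index, supplying the atom that stands for truth. *)
have [relU relX _] := relA _ (sentence_canonical U u0 [ffun=> set0] w).
have [f [fP fshop fX fU]] :=
  rmodels_canonical_exists u0U
    (relX.1 (relU.2 (rmodels_canonical_forall U u0 [ffun=> set0] w))).
exists f; split=> //; split=> // R a b aR ab.
(* [f] is itself a candidate, and it preserves the fact chosen against it, hence all facts. *)
have fE : finfun f =1 f by apply: ffunE.
have fFP : preserves (finfun f) (sval (tagged (w (finfun f)))).
  by move=> c hc; apply: fP => j; rewrite -fE.
have := wP _ fFP (Tagged _ (exist _ a aR)).
by apply=> j; rewrite fE; apply: ab.
Qed.
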